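(* Let $1\le r<n$ and let $M$ be a compact connected immersed hypersurface in $\mathbb{H}^n\times\mathbb{R}$ with prescribed $r$-mean curvature function $H_r:M\longrightarrow\left(0,\frac{n-r}{n}\right]$, such that $\partial M\subset\mathbb{H}^n\times\{0\}$. Let $\Omega\subset\mathbb{H}^n$ be the bounded domain such that $\partial M=\partial\Omega$. Then there exists a constant $C$ (depending on $\Omega$ and $n$) such that $|h(p)|\le C$ for all $p\in M$.
   Context: $\mathbb{H}^n$ is hyperbolic space, identified with $\mathbb{H}^n\times\{0\}$, and $\mathbb{H}^n\times\mathbb{R}$ has the product metric. For an oriented $n$-dimensional hypersurface with principal curvatures $k_1,\ldots,k_n$, $H_r=\binom{n}{r}^{-1}\sum_{i_1<\cdots<i_r}k_{i_1}\cdots k_{i_r}$ (a function on $M$, not assumed constant here). The height function $h:M\to\mathbb{R}$ of an immersion $\phi:M\to\mathbb{H}^n\times\mathbb{R}$ is $h(p)=\pi(\phi(p))$, where $\pi:\mathbb{H}^n\times\mathbb{R}\to\mathbb{R}$ is the natural projection. The constant $C$ does not depend on $M$ other than through $\Omega$ and $n$. *)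

(* Defs.v *)
From HB Require Import structures.
From mathcomp Require Import all_boot all_order all_algebra.
From mathcomp Require Import all_classical all_reals all_analysis.

Set Implicit Arguments.
Unset Strict Implicit.
Unset Printing Implicit Defensive.

Import Order.TTheory GRing.Theory Num.Theory.
Import numFieldNormedType.Exports.

Local Open Scope classical_set_scope.
Local Open Scope ring_scope.

(** H^n is the upper sheet <x,x> = -1, x_0 > 0 of the hyperboloid in Minkowski
    space R^{1,n}; its Riemannian metric is the restriction of the Lorentz
    form to tangent vectors. *)
Definition lorentz (R : realType) (n : nat) (x y : 'rV[R]_n.+1) : R :=
  - (x 0 ord0 * y 0 ord0) + \sum_(i < n) x 0 (lift ord0 i) * y 0 (lift ord0 i).

Definition hyperbolic_space (R : realType) (n : nat) : set 'rV[R]_n.+1 :=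
  [set x | lorentz x x = -1 /\ 0 < x 0 ord0].

(** cosh d(x, y) = - <x, y>, and arcosh c = ln (c + sqrt (c^2 - 1)). *)
Definition hyperbolic_dist (R : realType) (n : nat) (x y : 'rV[R]_n.+1) : R :=
  let c := - lorentz x y in ln (c + Num.sqrt (c ^+ 2 - 1)).

(** H^n is a closed, but not open, subset of R^{1,n}, so openness and the
    boundary of subsets of H^n are taken relatively to H^n. *)
Definition relatively_open (T : topologicalType) (A X : set T) : Prop :=
  exists2 U : set T, open U & X = U `&` A.

Definition relative_boundary (T : topologicalType) (A X : set T) : set T :=
  A `&` (closure X `&` closure (A `\` X)).

Record bounded_domain (R : realType) (n : nat) (Omega : set 'rV[R]_n.+1) :
    Prop := BoundedDomain {
  domain_sub : Omega `<=` @hyperbolic_space R n;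
  domain_open : relatively_open (@hyperbolic_space R n) Omega;
  domain_connected : connected Omega;
  domain_nonempty : Omega !=set0;
  domain_bounded : exists o : 'rV[R]_n.+1, @hyperbolic_space R n o /\
    exists rho : R, forall x, Omega x -> hyperbolic_dist o x <= rho }.

(** R^{1,n} x R, the flat pseudo-Riemannian space containing H^n x R; [pmetric]
    restricts to the product metric of H^n x R on tangent vectors. *)
Definition ambient (R : realType) (n : nat) : normedModType R :=
  ('rV[R]_n.+1 * R)%type.

Definition pmetric (R : realType) (n : nat) (v w : ambient R n) : R :=
  lorentz v.1 w.1 + v.2 * w.2.

Definition HxR (R : realType) (n : nat) : set (ambient R n) :=
  [set q | @hyperbolic_space R n q.1].

Definition slice0 (R : realType) (n : nat) (x : 'rV[R]_n.+1) : ambient R n :=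
  (x, 0).

Fixpoint Ck_on (R : realType) (V W : normedModType R) (k : nat) (U : set V)
    (f : V -> W) {struct k} : Prop :=
  match k with
  | 0%N => forall x, U x -> {for x, continuous f}
  | k'.+1 => (forall x, U x -> differentiable f x) /\
             (forall v, Ck_on k' U ('D_v f))
  end.

Definition smooth_on (R : realType) (V W : normedModType R) (U : set V)
    (f : V -> W) : Prop := forall k, Ck_on k U f.

(** The half-space x_0 >= 0 of R^n and its boundary hyperplane; the guard
    [i = 0%N :> nat] only serves to avoid writing n as a successor. *)
Definition half_space (R : realType) (n : nat) : set 'rV[R]_n :=
  [set x | forall i : 'I_n, i = 0%N :> nat -> 0 <= x 0 i].

Definition half_space_boundary (R : realType) (n : nat) : set 'rV[R]_n :=
  [set x | forall i : 'I_n, i = 0%N :> nat -> x 0 i = 0].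

(** A chart of M in which phi is a smooth immersion: a homeomorphism [coord],
    with inverse [param], of an open set of M onto a relatively open set
    [chart_range `&` half_space] of the half-space, such that phi o param
    extends to a smooth map [ext] on the open set [chart_range] with injective
    differential. Transition maps between two such charts are automatically
    smooth, because ext is locally an embedding; so the smooth structure of M
    is the one induced by phi and need not be given separately. *)
Record chart (R : realType) (n : nat) (M : topologicalType)
    (phi : M -> ambient R n) := Chart {
  chart_dom : set M;
  chart_range : set 'rV[R]_n;
  coord : M -> 'rV[R]_n;
  param : 'rV[R]_n -> M;
  ext : 'rV[R]_n -> ambient R n;
  chart_dom_open : open chart_dom;
  chart_range_open : open chart_range;
  coord_image : coord @` chart_dom = chart_range `&` @half_space R n;
  coordK : forall p, chart_dom p -> param (coord p) = p;
  coord_continuous : {within chart_dom, continuous coord};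
  param_continuous : {within chart_range `&` @half_space R n, continuous param};
  ext_smooth : smooth_on chart_range ext;
  extE : forall p, chart_dom p -> ext (coord p) = phi p;
  ext_immersion : forall x, (chart_range `&` @half_space R n) x ->
    injective ('d ext x : 'rV[R]_n -> ambient R n) }.

(** An n-manifold with (possibly empty) boundary immersed in H^n x R. *)
Record immersed_hypersurface (R : realType) (n : nat) (M : topologicalType)
    (phi : M -> ambient R n) : Prop := ImmersedHypersurface {
  hypersurface_hausdorff : hausdorff_space M;
  hypersurface_in_HxR : forall p, HxR (phi p);
  hypersurface_chart : forall p, exists c : chart phi, chart_dom c p }.

Definition manifold_boundary (R : realType) (n : nat) (M : topologicalType)
    (phi : M -> ambient R n) : set M :=
  [set p | exists c : chart phi,
     chart_dom c p /\ @half_space_boundary R n (coord c p)].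

Definition tangent_space (R : realType) (n : nat) (M : topologicalType)
    (phi : M -> ambient R n) (p : M) : set (ambient R n) :=
  [set v | exists c : chart phi,
     chart_dom c p /\ exists w, v = 'd (ext c) (coord c p) w].

(** An orientation, given as a continuous unit normal field; the first
    condition says that N p is tangent to H^n x R at phi p. *)
Record unit_normal_field (R : realType) (n : nat) (M : topologicalType)
    (phi N : M -> ambient R n) : Prop := UnitNormalField {
  normal_continuous : continuous N;
  normal_tangent_HxR : forall p, lorentz (phi p).1 (N p).1 = 0;
  normal_unit : forall p, pmetric (N p) (N p) = 1;
  normal_orthogonal : forall p v, tangent_space phi p v ->
    pmetric v (N p) = 0 }.

Definition partial (R : realType) (n : nat) (W : normedModType R) (i : 'I_n)
    (f : 'rV[R]_n -> W) : 'rV[R]_n -> W := 'D_(delta_mx 0 i) f.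

Definition first_form (R : realType) (n : nat) (F : 'rV[R]_n -> ambient R n)
    (x : 'rV[R]_n) : 'M[R]_n :=
  \matrix_(i, j) pmetric (partial i F x) (partial j F x).

(** The Levi-Civita connection of H^n x R is the tangential part of the flat
    derivative of R^{1,n} x R, and nu is tangent to H^n x R, so
    <nabla_{F_i} F_j, nu> = <F_ij, nu>. *)
Definition second_form (R : realType) (n : nat) (F : 'rV[R]_n -> ambient R n)
    (nu : ambient R n) (x : 'rV[R]_n) : 'M[R]_n :=
  \matrix_(i, j) pmetric (partial i (partial j F) x) nu.

(** Matrix of the shape operator X |-> - nabla_X N in the basis F_1, .., F_n. *)
Definition shape_operator (R : realType) (n : nat) (F : 'rV[R]_n -> ambient R n)
    (nu : ambient R n) (x : 'rV[R]_n) : 'M[R]_n :=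
  invmx (first_form F x) *m second_form F nu x.

(** [k] lists the eigenvalues of the shape operator at p, with multiplicity.
    This does not depend on the chart: changing it conjugates the matrix. *)
Definition principal_curvatures (R : realType) (n : nat) (M : topologicalType)
    (phi N : M -> ambient R n) (p : M) (k : 'I_n -> R) : Prop :=
  exists c : chart phi, chart_dom c p /\
    char_poly (shape_operator (ext c) (N p) (coord c p)) =
      \prod_(i < n) ('X - (k i)%:P).

Definition mean_curvature (R : realType) (n r : nat) (k : 'I_n -> R) : R :=
  ('C(n, r)%:R)^-1 * \sum_(I : {set 'I_n} | #|I| == r) \prod_(i in I) k i.

Definition height (R : realType) (n : nat) (M : topologicalType)
    (phi : M -> ambient R n) (p : M) : R := (phi p).2.

(* Main.v *)
Require Import Defs.
From HB Require Import structures.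
From mathcomp Require Import all_boot all_order all_algebra.
From mathcomp Require Import all_classical all_reals all_analysis.
From mathcomp Require Import ring lra.
Set Implicit Arguments.
Unset Strict Implicit.
Unset Printing Implicit Defensive.
Import Order.TTheory GRing.Theory Num.Theory.
Import numFieldNormedType.Exports.
Local Open Scope ring_scope.

(** The barrier is the entire rotational graph t = cosh d(o, x) + const, i.e.
    t + <o, x> = const in the Minkowski model: its principal curvatures are 1
    (n - 1 times) and 1 / cosh^2 d(o, x) > 0, so that H_r > (n - r) / n
    everywhere.  Minimise e t + <o, x>, with e = 1 or -1, over the compact M.
    At an interior minimum M lies on the convex side of a translate of the
    (possibly reflected) barrier, so that up to a global sign its principal
    curvatures are positive and all but one of them are at least 1; with
    H_r > 0 this gives H_r > (n - r) / n, a contradiction.  Hence the minimum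
    is attained on the boundary, where t = 0 and -<o, x> is bounded in terms
    of Omega. *)

(** * Symmetric pencils *)

(** The rank decomposition of [v] is a unit 1 by 1 matrix times the first row of the unit matrix
    [row_ebase v]. Absorbing the former into that first row gives [Q]. *)
Lemma unit_first_row (F : fieldType) n (v : 'rV[F]_(1 + n)) :
  v != 0 -> exists2 Q : 'M[F]_(1 + n), Q \in unitmx & usubmx Q = v.
Proof.
move=> v0.
have rv : \rank v = 1%N by rewrite rank_rV v0.
have vE := mulmx_ebase v; rewrite rv in vE.
exists (block_mx (col_ebase v) 0 0 1%:M *m row_ebase v).
  by rewrite unitmx_mul row_ebase_unit andbT unitmxE det_ublock det1 mulr1
    -unitmxE col_ebase_unit.
rewrite -[RHS]vE -mul_usub_mx /block_mx col_mxKu; congr (_ *m _).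
have -> : (pid_mx 1 : 'M[F]_(1, 1 + n)) = row_mx 1%:M 0.
  by rewrite -[LHS]hsubmxK; congr row_mx; apply/matrixP=> i j; rewrite !mxE ?ord1 //= andbF.
by rewrite mul_mx_row mulmx1 mulmx0.
Qed.

(** The matrix [X G - B], whose determinant is [\det G] times the characteristic polynomial of
    [G^-1 B]. It replaces the shape operator, which need not be symmetric, by the two symmetric
    fundamental forms, and congruence changes its determinant only by a scalar. *)
Definition pencil (R : comNzRingType) n (G B : 'M[R]_n) : 'M[{poly R}]_n :=
  'X *: map_mx polyC G - map_mx polyC B.

Lemma pencil_congr (R : comNzRingType) n (G B P : 'M[R]_n) :
  \det (pencil (P *m G *m P^T) (P *m B *m P^T)) =
  (\det P ^+ 2) *: \det (pencil G B).
Proof.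
have -> : pencil (P *m G *m P^T) (P *m B *m P^T) =
    map_mx polyC P *m pencil G B *m (map_mx polyC P)^T.
  by rewrite /pencil !map_mxM map_trmx mulmxBr mulmxBl -scalemxAr -scalemxAl.
by rewrite !det_mulmx det_tr det_map_mx -mul_polyC polyC_exp; ring.
Qed.

Lemma pencil_block (R : comNzRingType) n (a b : R) (G B : 'M[R]_n) :
  \det (pencil (block_mx a%:M 0 0 G : 'M[R]_(1 + n)) (block_mx b%:M 0 0 B)) =
  (a *: 'X - b%:P) * \det (pencil G B).
Proof.
have -> : pencil (block_mx a%:M 0 0 G : 'M[R]_(1 + n)) (block_mx b%:M 0 0 B) =
    block_mx (a *: 'X - b%:P)%:M 0 0 (pencil G B).
  rewrite /pencil !map_block_mx scale_block_mx opp_block_mx add_block_mx !map_mx0.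
  rewrite !(scaler0, subr0) !map_scalar_mx scale_scalar_mx -[- _%:M]raddfN /= -raddfD /=.
  by rewrite mulrC mul_polyC.
by rewrite det_ublock det_scalar1.
Qed.

Lemma horner_det_pencil (R : comNzRingType) n (G B : 'M[R]_n) x :
  (\det (pencil G B)).[x] = \det (x *: G - B).
Proof.
rewrite -horner_evalE -det_map_mx; congr (\det _).
by apply/matrixP=> i j; rewrite !mxE /= /horner_eval !hornerE.
Qed.

Lemma det_pencil (R : comUnitRingType) n (G B : 'M[R]_n) : G \in unitmx ->
  \det (pencil G B) = \det G *: char_poly (invmx G *m B).
Proof.
move=> Gu; rewrite -mul_polyC -det_map_mx /char_poly -det_mulmx; congr (\det _).
rewrite mulmxBr -map_mxM mulmxA mulmxV // mul1mx /pencil; congr (_ - _).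
by rewrite mul_mx_scalar.
Qed.

(* Deflation: split off a G-unit eigenvector v and continue on the
   G-orthogonal complement of v, which B preserves by symmetry. *)
Lemma simultaneous_diagonalization (R : rcfType) n (G B : 'M[R]_n)
    (k : 'I_n -> R) (c : R) :
  (forall v : 'rV_n, v != 0 -> 0 < (v *m G *m v^T) 0 0) ->
  G^T = G -> B^T = B -> c != 0 ->
  \det (pencil G B) = c *: \prod_(i < n) ('X - (k i)%:P) ->
  exists P : 'M[R]_n, P *m G *m P^T = 1%:M /\
    P *m B *m P^T = diag_mx (\row_i k i).
Proof.
elim: n G B k c => [|n IH] G B k c.
  by move=> *; exists 1%:M; split; apply/matrixP=> i; case: (i) => -[].
move: G B k; rewrite -[n.+1]/(1 + n)%N => G B k Gpos Gsym Bsym c0 detE.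
have [v v0 vk] : exists2 v : 'rV[R]_(1 + n), v != 0 & v *m (k ord0 *: G - B) = 0.
  apply/det0P/eqP; rewrite -horner_det_pencil detE hornerZ horner_prod.
  by rewrite big_ord_recl hornerXsubC subrr mul0r mulr0.
have vB : v *m B = k ord0 *: (v *m G).
  by apply/esym/eqP; rewrite -subr_eq0 scalemxAr -mulmxBr vk.
wlog vGv : v v0 {vk} vB / v *m G *m v^T = 1%:M.
  move=> /(_ ((Num.sqrt ((v *m G *m v^T) 0 0))^-1 *: v)); apply.
  - by rewrite scaler_eq0 negb_or v0 andbT invr_eq0 sqrtr_eq0 -ltNge Gpos.
  - by rewrite -!scalemxAl vB !scalerA mulrC.
  - rewrite linearZ /= -!scalemxAl -scalemxAr scalerA -invfM -expr2 sqr_sqrtr ?ltW ?Gpos//.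
    by rewrite [v *m _ *m _]mx11_scalar scale_scalar_mx mxE eqxx mulVf // gt_eqF // Gpos.
have [Q Qu Qv] := unit_first_row v0.
pose s := dsubmx Q *m G *m v^T.
pose W := dsubmx Q - s *m v.
have WG : W *m G *m v^T = 0.
  by rewrite !mulmxBl -(mulmxA s v G) -(mulmxA s (v *m G)) vGv mulmx1 subrr.
have vW : v *m G *m W^T = 0.
  by apply: trmx_inj; rewrite !trmx_mul trmxK Gsym trmx0 mulmxA.
pose P : 'M[R]_(1 + n) := col_mx v W.
have PE : P = block_mx 1%:M 0 (- s) 1%:M *m Q.
  by rewrite -[Q in RHS]vsubmxK Qv mul_block_col !mul1mx mul0mx addr0 mulNmx addrC.
have Pu : P \in unitmx by rewrite PE unitmx_mul Qu andbT unitmxE det_lblock !det1 mulr1 unitr1.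
have PG : P *m G *m P^T = block_mx 1%:M 0 0 (W *m G *m W^T).
  by rewrite mul_col_mx tr_col_mx mul_col_row vGv vW WG.
have PB : P *m B *m P^T = block_mx (k ord0)%:M 0 0 (W *m B *m W^T).
  rewrite mul_col_mx tr_col_mx mul_col_row vB -!scalemxAl vGv vW scaler0 scale_scalar_mx mulr1.
  congr block_mx; apply: trmx_inj.
  by rewrite !trmx_mul trmxK Bsym trmx0 mulmxA vB -scalemxAl vW scaler0.
have WvG (u : 'rV_n) : u != 0 -> 0 < (u *m (W *m G *m W^T) *m u^T) 0 0.
  move=> u0; have := Gpos (u *m W); rewrite trmx_mul !mulmxA; apply.
  apply: contraNneq u0 => uW.
  have : row_mx 0 u *m P = 0 by rewrite mul_row_col uW mul0mx addr0.
  move/(congr1 (mulmx^~ (invmx P))); rewrite mulmxK // mul0mx -[RHS]row_mx0.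
  by move/eq_row_mx => [_ ->].
have dP : \det P != 0 by rewrite -unitfE -unitmxE.
(* The free constant [c] of the statement absorbs the factor [\det P ^+ 2] of the congruence; the
   linear factor of [k ord0] is then cancelled on both sides. *)
have [||||P' [P'G P'B]] := IH (W *m G *m W^T) (W *m B *m W^T)
    (fun i => k (lift ord0 i)) (\det P ^+ 2 * c) WvG.
- by rewrite !trmx_mul trmxK Gsym mulmxA.
- by rewrite !trmx_mul trmxK Bsym mulmxA.
- by rewrite mulf_neq0 // expf_neq0.
- have := pencil_congr G B P; rewrite PG PB pencil_block detE scale1r scalerA.
  by rewrite big_ord_recl scalerAr => /mulfI -> //; rewrite polyXsubC_eq0.
exists (block_mx 1%:M 0 0 P' *m P); split.
  rewrite trmx_mul !mulmxA -(mulmxA _ P G) -(mulmxA _ _ P^T) PG.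
  rewrite tr_block_mx !trmx0 trmx1 !mulmx_block
    !(mul0mx, mulmx0, mul1mx, mulmx1, addr0, add0r).
  by rewrite P'G -scalar_mx_block.
rewrite trmx_mul !mulmxA -(mulmxA _ P B) -(mulmxA _ _ P^T) PB.
rewrite tr_block_mx !trmx0 trmx1 !mulmx_block !(mul0mx, mulmx0, mul1mx, mulmx1, addr0, add0r).
have -> : \row_i k i = row_mx (k ord0)%:M (\row_i k (lift ord0 i)).
  apply/rowP=> i; rewrite mxE; case: (split_ordP i) => j ->.
    by rewrite row_mxEl ord1 mxE mulr1n; congr k; apply/val_inj.
  by rewrite row_mxEr mxE; congr k; apply/val_inj.
rewrite P'B diag_mx_row; congr block_mx.
by apply/matrixP=> i j; rewrite !ord1 !mxE.
Qed.

(** After simultaneous diagonalization both forms are weighted sums of squares. Eigenvectors give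
    positivity. Two eigenvalues below 1 would make [s B] smaller than [G] on a plane, and every
    plane meets the hyperplane [v *m t = 0] nontrivially. *)
Lemma eigenvalues_ge1 (R : rcfType) n (G B : 'M[R]_n) (t : 'cV_n)
    (k : 'I_n -> R) (c s : R) :
  (forall v : 'rV_n, v != 0 -> 0 < (v *m G *m v^T) 0 0) ->
  G^T = G -> B^T = B -> c != 0 ->
  \det (pencil G B) = c *: \prod_(i < n) ('X - (k i)%:P) ->
  (forall v : 'rV_n, v != 0 -> 0 < s * (v *m B *m v^T) 0 0) ->
  (forall v : 'rV_n, (v *m t) 0 0 = 0 ->
     (v *m G *m v^T) 0 0 <= s * (v *m B *m v^T) 0 0) ->
  (forall i, 0 < s * k i) /\ (forall i j, i != j -> s * k i < 1 -> 1 <= s * k j).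
Proof.
move=> Gpos Gsym Bsym c0 detE Bpos Bge.
have [P [PG PB]] := simultaneous_diagonalization Gpos Gsym Bsym c0 detE.
have PuT : P \in unitmx.
  by have /mulmx1_unit[] : P *m (G *m P^T) = 1%:M by rewrite mulmxA.
have qG (u : 'rV_n) : (u *m P *m G *m (u *m P)^T) 0 0 = \sum_i u 0 i ^+ 2.
  rewrite trmx_mul !mulmxA -(mulmxA u) -(mulmxA u) PG mulmx1 mxE.
  by apply: eq_bigr => i _; rewrite mxE.
have qB (u : 'rV_n) :
    s * (u *m P *m B *m (u *m P)^T) 0 0 = \sum_i s * k i * u 0 i ^+ 2.
  rewrite trmx_mul !mulmxA -(mulmxA u) -(mulmxA u) PB mul_mx_diag mxE mulr_sumr.
  by apply: eq_bigr => i _; rewrite !mxE; ring.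
split=> [i|i j ij ki].
  have := Bpos (delta_mx 0 i *m P); rewrite qB (bigD1 i) //= big1 => [|j ji].
    rewrite mxE !eqxx expr1n mulr1 addr0; apply.
    apply/eqP => /(congr1 (mulmx^~ (invmx P))); rewrite mulmxK // mul0mx.
    by move/matrixP/(_ 0 i)/eqP; rewrite !mxE !eqxx oner_eq0.
  by rewrite mxE (negPf ji) andbF expr0n mulr0.
rewrite leNgt; apply/negP => kj.
(* The span of the two eigenvectors meets {v | v *m t = 0} in u *m P, u <> 0. *)
pose y := P *m t.
(* If both coordinates of [y] vanish, the whole plane lies in the hyperplane and any nonzero pair
   serves. *)
pose ab := if (y i 0 == 0) && (y j 0 == 0) then (1, 0) else (y j 0, - y i 0).
pose u : 'rV[R]_n := ab.1 *: delta_mx 0 i + ab.2 *: delta_mx 0 j.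
have ui : u 0 i = ab.1 by rewrite !mxE !eqxx (negPf ij) /= mulr1 mulr0 addr0.
have uj : u 0 j = ab.2 by rewrite !mxE !eqxx eq_sym (negPf ij) /= mulr1 mulr0 add0r.
have uo l : l != i -> l != j -> u 0 l = 0.
  by move=> /negPf li /negPf lj; rewrite !mxE li lj /= !mulr0 addr0.
have sum2 (f : 'I_n -> R) : (forall l, l != i -> l != j -> f l = 0) ->
    \sum_l f l = f i + f j.
  move=> f0; rewrite (bigD1 i) // (bigD1 j) 1?eq_sym //= big1 ?addr0 //.
  by move=> l /andP[]; exact: f0.
have := Bge (u *m P).
rewrite qG qB !sum2; last 2 first.
- by move=> l li lj; rewrite uo ?expr0n ?mulr0.
- by move=> l li lj; rewrite uo ?expr0n.
rewrite ui uj -mulmxA -/y mulmxDl -!scalemxAl -!rowE !mxE => H.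
have : ab.1 * y i 0 + ab.2 * y j 0 = 0 /\ 0 < ab.1 ^+ 2 + ab.2 ^+ 2.
  rewrite /ab; case: ifP => [/andP[/eqP -> /eqP ->]|] /=.
    by split; [ring|rewrite expr1n expr0n addr0].
  move/negbT; rewrite negb_and => /orP h; split; first ring.
  case: h => h; [apply: ltr_wpDl|apply: ltr_pwDl]; rewrite ?sqr_ge0 //.
    by rewrite exprn_even_gt0 //= oppr_eq0.
  by rewrite exprn_even_gt0.
move=> [e ab0]; rewrite /y !mxE in e; have {e}H := H e;
(* On the plane the form [s B] is at most this maximum times the sum of squares, hence strictly
   below [G]. *)
have m1 : Num.max (s * k i) (s * k j) < 1 by rewrite gt_max ki kj.
have {}H : ab.1 ^+ 2 + ab.2 ^+ 2 <= Num.max (s * k i) (s * k j) * (ab.1 ^+ 2 + ab.2 ^+ 2).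
  apply: le_trans H _; rewrite mulrDr lerD // ler_wpM2r ?sqr_ge0 // le_max lexx //.
  by rewrite orbT.
by move: H; rewrite leNgt gtr_pMl // m1.
Qed.

(** * Elementary symmetric functions *)

(** At most one index [i0] carries a value below 1. The ['C(n.-1, r)] subsets avoiding [i0]
    contribute at least 1 each, and the subsets through [i0] add a positive amount, which makes the
    inequality strict. *)
Lemma elementary_symmetric_gt_bin (R : realDomainType) n r (k : 'I_n -> R) :
  (1 <= r <= n)%N -> (forall i, 0 < k i) ->
  (forall i j, i != j -> k i < 1 -> 1 <= k j) ->
  'C(n.-1, r)%:R < \sum_(I : {set 'I_n} | #|I| == r) \prod_(i in I) k i.
Proof.
move=> /andP[r1 rn] kpos k1.
have n0 : (0 < n)%N by exact: leq_trans rn.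
have [i0 ki0] : exists i0, forall j, j != i0 -> 1 <= k j.
  have [/existsP[i ki]|/existsPn h] := boolP [exists i, k i < 1].
    by exists i => j ji; apply: k1 ki; rewrite eq_sym.
  by exists (Ordinal n0) => j _; rewrite leNgt h.
have cardC : #|[set~ i0]| = n.-1 by rewrite cardsC1 card_ord.
rewrite (bigID (fun I : {set 'I_n} => i0 \in I)) /= addrC.
have -> : \sum_(I : {set 'I_n} | (#|I| == r) && (i0 \notin I)) \prod_(i in I) k i =
    \sum_(I in [set A : {set 'I_n} | A \subset [set~ i0] & #|A| == r])
      \prod_(i in I) k i.
  apply: eq_bigl => I; rewrite inE andbC; congr (_ && _).
  by rewrite finset.subsetC finset.sub1set inE.
have le1 : 'C(n.-1, r)%:R <=
    \sum_(I in [set A : {set 'I_n} | A \subset [set~ i0] & #|A| == r])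
      \prod_(i in I) k i.
  rewrite -cardC -cards_draws -sum1_card natr_sum; apply: ler_sum => I.
  rewrite inE => /andP[/fintype.subsetP sI _].
  rewrite -[1%:R](big1_eq (op := *%R) (index_enum _) (mem I)).
  apply: ler_prod => i /sI; rewrite !inE => /ki0 ->.
  by rewrite ler01.
apply: le_lt_trans le1 _; rewrite ltrDl.
(* Adjoining [i0] to such a [J] gives a subset of size [r] through [i0]; both [1 <= r] and [r <= n]
   enter here. *)
have /card_gt0P[J] : (0 < #|[set A : {set 'I_n} | A \subset [set~ i0] & #|A| == r.-1]|)%N.
  by rewrite cards_draws cardC bin_gt0;
    case: r n rn r1 {k kpos k1 i0 ki0 cardC n0} => [|r] [|n].
rewrite inE => /andP[/fintype.subsetP sJ /eqP cJ].
rewrite (bigD1 (i0 |: J)) /=.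
  apply: ltr_pwDl; first by apply: prodr_gt0 => i _.
  by apply: sumr_ge0 => I _; apply: prodr_ge0 => i _; apply: ltW.
rewrite finset.setU11 andbT cardsU1 cJ.
by case: (boolP (i0 \in J)) => [/sJ|_]; rewrite ?inE ?eqxx // add1n prednK.
Qed.


(** * Second derivatives *)

Local Open Scope classical_set_scope.
Local Open Scope ring_scope.

Section calculus.
Variables (R : realType) (V : normedModType R).
Implicit Types (f : V -> R) (x v w : V).

(** Both difference quotients are the same function of [h]. This brings directional derivatives
    under the one-variable mean value theorem. *)
Lemma is_derive_line f x v (t : R) : derivable f (x + t *: v) v ->
  is_derive t 1 (fun s => f (x + s *: v)) ('D_v f (x + t *: v)).
Proof.
move=> df; have E : (fun h : R => h^-1 *: (((fun s => f (x + s *: v)) \o shift t) (h *: 1)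
    - f (x + t *: v))) =
    (fun h => h^-1 *: ((f \o shift (x + t *: v)) (h *: v) - f (x + t *: v))).
  apply/funext => h /=; congr (_ *: (f _ - _)).
  by rewrite [h%:A]mulr1 scalerDl addrCA.
by split; rewrite /derivable /derive E.
Qed.

Lemma diff_expand f x (e : R) : differentiable f x -> 0 < e ->
  \forall y \near x, `|f y - f x - 'd f x (y - x)| <= e * `|y - x|.
Proof.
move=> df e0; have /eqaddoP := diff_locally df.
move=> /(_ e e0) H; rewrite (near_shift 0) /= subr0.
apply: filterS H => h /=; rewrite !fctE /= addrK.
by rewrite opprD addrA.
Qed.

Lemma near_line x v w (P : V -> Prop) : (\forall y \near x, P y) ->
  \forall s \near 0^'+, forall a b : R, `|a| <= s -> `|b| <= s -> P (x + (a *: v + b *: w)).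
Proof.
move=> /nbhs_normP[r /= r0 rP].
(* The summand 1 keeps the divisor positive when [v] and [w] vanish. *)
have M0 : 0 < `|v| + `|w| + 1 by rewrite ltr_wpDl // addr_ge0.
near=> s => a b la lb; apply: rP; rewrite /ball_ /= opprD addrA subrr sub0r normrN.
apply: le_lt_trans (_ : s * (`|v| + `|w| + 1) < _).
  apply: le_trans (ler_normD _ _) _; rewrite !normrZ mulrDr mulr1 mulrDr.
  have s0 : 0 <= s by exact: le_trans la.
  by rewrite -[leLHS]addr0 lerD // lerD // ler_wpM2r.
rewrite -ltr_pdivlMr //; near: s; apply: nbhs_right_lt; exact: divr_gt0.
Unshelve. all: by end_near. Qed.

Lemma MVT_line f x v (s : R) : 0 < s ->
  (forall t, 0 <= t <= s -> derivable f (x + t *: v) v) ->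
  exists2 c, 0 < c < s & f (x + s *: v) - f x = 'D_v f (x + c *: v) * s.
Proof.
move=> s0 df.
have [||c cs] := @MVT R (fun t => f (x + t *: v)) (fun t => 'D_v f (x + t *: v)) 0 s s0.
- move=> t; rewrite in_itv /= => /andP[t0 ts]; apply: is_derive_line.
  by apply: df; rewrite !ltW.
- apply: derivable_within_continuous => t; rewrite in_itv /= => ts.
  by have [] := is_derive_line (df _ ts).
by rewrite scale0r addr0 subr0 => ->; exists c; rewrite // in_itv in cs.
Qed.

(** Subtracting two first-order expansions at one base point cancels [d] and [c * dv]; only [s * dw]
    and the two errors remain. *)
Let bound_by_expansions (d1 d0 d dv dw c s q a b m : R) :
  `|d0 - d - c * dv| <= q * (c * a) ->
  `|d1 - d - (c * dv + s * dw)| <= q * (c * a + s * b) ->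
  0 <= q -> c * a <= s * a -> q * (s * (a + a + b)) <= m ->
  `|d1 - d0 - s * dw| <= m.
Proof.
move=> /ler_normlP[H01 H02] /ler_normlP[H11 H12] q0 ca H.
have : q * (c * a) <= q * (s * a) by rewrite ler_wpM2l.
rewrite ler_norml => H'; apply/andP; split; lra.
Qed.

(* Mean value theorem in direction v for y |-> f (y + s w) - f y. *)
Lemma second_difference f x v w (e : R) : 0 < e ->
  (\forall y \near x, differentiable f y) -> differentiable ('D_v f) x ->
  \forall s \near 0^'+,
    `|f (x + s *: w + s *: v) - f (x + s *: w) - (f (x + s *: v) - f x)
      - s ^+ 2 * 'D_w ('D_v f) x| <= e * s ^+ 2.
Proof.
(* The norm of [v] is counted twice because the errors of two expansions are added, and both points
   are displaced along [v]. *)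
move=> e0 df ddf; pose M := `|v| + `|v| + `|w| + 1.
have M0 : 0 < M by rewrite ltr_wpDl // !addr_ge0.
have : \forall y \near x, `|'D_v f y - 'D_v f x - 'd ('D_v f) x (y - x)| <= e / M * `|y - x|.
  by apply: diff_expand => //; exact: divr_gt0.
move=> /(filterI df) /(near_line v w) /(filterI (@nbhs_right_gt R 0)).
apply: filterS => s [/= s0 {}df].
have ss : `|s| <= s by rewrite ger0_norm // ltW.
pose g t := f (x + s *: w + t *: v) - f (x + t *: v).
have inS t : 0 <= t <= s -> `|t| <= s by move=> /andP[t0 ts]; rewrite ger0_norm.
have dfE (t b : R) : x + (t *: v + b *: w) = x + b *: w + t *: v.
  by rewrite addrAC addrA.
have dw t : 0 <= t <= s -> derivable f (x + s *: w + t *: v) v.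
  by move=> /inS ts; rewrite -dfE; apply: diff_derivable; have [] := df t s ts ss.
have d0 t : 0 <= t <= s -> derivable f (x + t *: v) v.
  move=> /inS ts; apply: diff_derivable; have := df t 0 ts.
  by rewrite normr0 scale0r addr0 ltW // => /(_ isT)[].
pose dg t := 'D_v f (x + s *: w + t *: v) - 'D_v f (x + t *: v).
have dgE t : 0 <= t <= s -> is_derive t 1 g (dg t).
  by move=> ts; apply: is_deriveB; apply: is_derive_line; [exact: dw|exact: d0].
have [||c] := @MVT R g dg 0 s s0.
- by move=> t; rewrite in_itv /= => /andP[t0 ts]; apply: dgE; rewrite !ltW.
- apply: derivable_within_continuous => t; rewrite in_itv /= => ts.
  by have [] := dgE _ ts.
rewrite in_itv subr0 /g !scale0r !addr0 => /andP[c0 cs].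
have cS : `|c| <= s by rewrite gtr0_norm // ltW.
set D := 'D_v f; set Dw := 'D_w D x => E.
have dD h : 'd D x h = 'D_h D x by rewrite deriveE.
have H1 : `|D (x + s *: w + c *: v) - D x - (c * 'D_v D x + s * Dw)| <=
    e / M * (c * `|v| + s * `|w|).
  have [_] := df c s cS ss; rewrite [x + _ - x]addrC addKr dfE.
  rewrite raddfD /= !linearZ /= !dD => /le_trans; apply.
  apply: ler_wpM2l; first by rewrite divr_ge0 ?ltW.
  by apply: le_trans (ler_normD _ _) _; rewrite !normrZ !gtr0_norm.
have H0 : `|D (x + c *: v) - D x - c * 'D_v D x| <= e / M * (c * `|v|).
  have [|_] := df c 0 cS; first by rewrite normr0 ltW.
  rewrite scale0r addr0 [x + _ - x]addrC addKr linearZ /= dD normrZ.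
  by rewrite (gtr0_norm c0).
have -> : f (x + s *: w + s *: v) - f (x + s *: w) - (f (x + s *: v) - f x) = dg c * s.
  by rewrite -E; ring.
have -> : dg c = D (x + s *: w + c *: v) - D (x + c *: v) by [].
set d1 := D _; set d0' := D _.
have -> : (d1 - d0') * s - s ^+ 2 * Dw = s * (d1 - d0' - s * Dw) by ring.
rewrite normrM gtr0_norm // expr2 mulrCA ler_pM2l //.
apply: bound_by_expansions H0 H1 _ _ _.
- by rewrite ltW // divr_gt0.
- by rewrite ler_wpM2r // ltW.
- have <- : e / M * (s * M) = e * s by rewrite mulrCA divfK ?gt_eqF // mulrC.
  by rewrite !ler_wpM2l ?ltW ?divr_gt0 // /M ltrDl.
Qed.

Let bound_by_common_value (m p q s e : R) : 0 < s ->
  `|m - s ^+ 2 * p| <= e / 2 * s ^+ 2 -> `|m - s ^+ 2 * q| <= e / 2 * s ^+ 2 ->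
  `|p - q| <= 0 + e.
Proof.
move=> s0 Hp Hq; rewrite add0r -(ler_pM2r (exprn_gt0 2 s0)).
rewrite -{1}(gtr0_norm (exprn_gt0 2 s0)) -normrM.
have -> : (p - q) * s ^+ 2 = (m - s ^+ 2 * q) - (m - s ^+ 2 * p) by ring.
by apply: le_trans (ler_normB _ _) _; lra.
Qed.

(** Young's form of Schwarz's theorem. The second difference over the parallelogram with sides [s v]
    and [s w] is symmetric in [v] and [w], and up to [o(s^2)] it equals [s^2] times either mixed
    derivative. *)
Lemma symmetric_second_derivative f x v w :
  (\forall y \near x, differentiable f y) ->
  differentiable ('D_v f) x -> differentiable ('D_w f) x ->
  'D_w ('D_v f) x = 'D_v ('D_w f) x.
Proof.
move=> df dv dw; apply/eqP; rewrite -subr_eq0 -normr_le0; apply/ler_addgt0Pr => e e0.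
have e2 : 0 < e / 2 by rewrite divr_gt0.
have [s /= [s0 [+ +]]] : exists s : R, [set s | 0 < s] s /\
    (`|f (x + s *: w + s *: v) - f (x + s *: w) - (f (x + s *: v) - f x)
      - s ^+ 2 * 'D_w ('D_v f) x| <= e / 2 * s ^+ 2 /\
    `|f (x + s *: v + s *: w) - f (x + s *: v) - (f (x + s *: w) - f x)
      - s ^+ 2 * 'D_v ('D_w f) x| <= e / 2 * s ^+ 2).
  apply: (@filter_ex _ (0 : R)^'+); apply: filterI; first exact: nbhs_right_gt.
  by apply: filterI; [exact: second_difference e2 df dv|exact: second_difference e2 df dw].
rewrite (addrAC x (s *: v)) => Hv Hw; apply: bound_by_common_value s0 Hv _.
by rewrite [X in X - s ^+ 2 * _](_ : _ = f (x + s *: w + s *: v) - f (x + s *: v) -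
  (f (x + s *: w) - f x)) //; ring.
Qed.

(** Fermat's rule on the line through [x] gives the first claim. If the second derivative were
    negative, the first would be negative just past [x], whereas the mean value theorem and
    minimality produce a point there where it is nonnegative. *)
Lemma second_derivative_test f x v :
  (\forall y \near x, differentiable f y) -> differentiable ('D_v f) x ->
  (\forall y \near x, f x <= f y) -> 'D_v f x = 0 /\ 0 <= 'D_v ('D_v f) x.
Proof.
move=> df ddf fmin; pose M := `|v| + 1.
have M0 : 0 < M by rewrite ltr_wpDl.
have near_line1 (P : V -> Prop) : (\forall y \near x, P y) ->
    exists2 s : R, 0 < s & forall a : R, `|a| <= s -> P (x + a *: v).
  move=> /(near_line v 0) Hn; near (0 : R)^'+ => s.
  exists s; first by near: s; exact: nbhs_right_gt.
  have : forall a b : R, `|a| <= s -> `|b| <= s -> P (x + (a *: v + b *: 0)).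
    by near: s; exact: Hn.
  by move=> H a la; have := H a a la la; rewrite scaler0 addr0.
have Dv0 : 'D_v f x = 0.
  have [s s0 H] := near_line1 _ (filterI df fmin).
  have inS t : t \in `]-s, s[ -> `|t| <= s.
    by rewrite in_itv /= -ltr_norml => /ltW.
  have s00 : 0 \in `]-s, s[ by rewrite in_itv /= oppr_lt0 s0.
  have dl t : t \in `]-s, s[ -> derivable (fun a : R => f (x + a *: v)) t 1.
    move=> /inS /H[dft _].
    by have [] := is_derive_line (diff_derivable (v := v) dft).
  have D0 : is_derive (0:R) 1 (fun a : R => f (x + a *: v)) 0.
    apply: (@derive1_at_min _ _ (- s) s) => //; first by rewrite ge0_cp ?ltW.
    by move=> t /inS /H[_]; rewrite scale0r addr0.
  have [df0 _] := H 0 (inS _ s00).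
  have [_] := is_derive_line (diff_derivable (v := v) df0).
  have [_ ->] := D0; rewrite scale0r addr0 => <- //.
split=> //; rewrite leNgt; apply/negP => D2.
pose a : R := - 'D_v ('D_v f) x; have a0 : 0 < a by rewrite oppr_gt0.
(* With this tolerance the error at [x + c v] is at most [a c / 2], half the size of the linear term
   [- a c]. *)
have : \forall y \near x,
    `|'D_v f y - 'D_v f x - 'd ('D_v f) x (y - x)| <= a / 2 / M * `|y - x|.
  by apply: diff_expand => //; rewrite !divr_gt0.
move=> /(filterI (filterI df fmin)) /near_line1[s s0 H].
have [|c /andP[c0 cs]] := @MVT_line f x v s s0.
  move=> t /andP[t0 ts]; apply: diff_derivable.
  by have /H[[]] : `|t| <= s by rewrite ger0_norm.
have /H[[_ fs] _] : `|s| <= s by rewrite gtr0_norm.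
have /H[_] : `|c| <= s by rewrite gtr0_norm // ltW.
rewrite Dv0 subr0 [x + _ - x]addrC addKr linearZ /= -deriveE // -[_ *: 'D_v _ _]/(c * _).
rewrite normrZ gtr0_norm // => /ler_normlP[_ Hc] E.
have D0 : 0 <= 'D_v f (x + c *: v) by rewrite -(pmulr_lge0 _ s0) -E subr_ge0.
rewrite -['D_v ('D_v f) x]opprK -/a in Hc.
suff arith (d q : R) : 0 <= d -> q <= a / 2 * c -> d - c * - a <= q -> False.
  apply: arith D0 _ Hc.
  rewrite -mulrA; apply: ler_wpM2l; first by rewrite divr_ge0 // ltW.
  rewrite mulrC ler_pdivrMr //; apply: ler_wpM2l; first exact: ltW.
  by rewrite /M lerDl.
have : 0 < a * c by rewrite mulr_gt0.
by move=> *; lra.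
Unshelve. all: by end_near. Qed.

End calculus.

(** * Hyperbolic space in Minkowski space *)

Section lorentz_algebra.
Variables (R : realType) (n : nat).
Implicit Types (x y z : 'rV[R]_n.+1) (u v w : ambient R n).

Lemma lorentzC x y : lorentz x y = lorentz y x.
Proof. by rewrite /lorentz mulrC; under eq_bigr do rewrite mulrC. Qed.

Lemma lorentzDl x y z : lorentz (x + y) z = lorentz x z + lorentz y z.
Proof.
rewrite /lorentz mxE addrACA -big_split /= mulrDl opprD; congr (_ + _).
by apply: eq_bigr => i _; rewrite mxE mulrDl.
Qed.

Lemma lorentzZl a x z : lorentz (a *: x) z = a * lorentz x z.
Proof.
rewrite /lorentz mxE mulrDr mulrN mulrA mulr_sumr; congr (_ + _).
by apply: eq_bigr => i _; rewrite mxE mulrA.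
Qed.

Lemma pmetricC u v : pmetric u v = pmetric v u.
Proof. by rewrite /pmetric lorentzC mulrC. Qed.

Lemma pmetricDl u v w : pmetric (u + v) w = pmetric u w + pmetric v w.
Proof. by rewrite /pmetric /= lorentzDl mulrDl addrACA. Qed.

Lemma pmetricZl a v w : pmetric (a *: v) w = a * pmetric v w.
Proof. by rewrite [RHS]mulrDr [X in _ = _ + X]mulrA /pmetric /= lorentzZl. Qed.

Lemma pmetricDr u v w : pmetric w (u + v) = pmetric w u + pmetric w v.
Proof. by rewrite !(pmetricC w) pmetricDl. Qed.

Lemma pmetricZr a v w : pmetric w (a *: v) = a * pmetric w v.
Proof. by rewrite !(pmetricC w) pmetricZl. Qed.

Lemma pmetric0l w : pmetric 0 w = 0.
Proof. by rewrite -(scale0r (0 : ambient R n)) pmetricZl mul0r. Qed.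

Lemma pmetric0r w : pmetric w 0 = 0.
Proof. by rewrite pmetricC pmetric0l. Qed.

Lemma pmetric_suml I (r : seq I) (P : pred I) (F : I -> ambient R n) w :
  pmetric (\sum_(i <- r | P i) F i) w = \sum_(i <- r | P i) pmetric (F i) w.
Proof.
by apply: (big_morph (fun u => pmetric u w)) => [u v|]; rewrite ?pmetricDl ?pmetric0l.
Qed.

Lemma pmetric_sumr I (r : seq I) (P : pred I) (F : I -> ambient R n) w :
  pmetric w (\sum_(i <- r | P i) F i) = \sum_(i <- r | P i) pmetric w (F i).
Proof. by rewrite pmetricC pmetric_suml; under eq_bigr do rewrite pmetricC. Qed.

Lemma lorentz_sqr x :
  \sum_(i < n) x 0 (lift ord0 i) ^+ 2 = lorentz x x + x 0 ord0 ^+ 2.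
Proof. by rewrite /lorentz expr2 addrAC addNr add0r. Qed.

(** Reverse Cauchy-Schwarz: with time coordinates [a] of [x] and [b] of [y], the combination
    [b x - a y] has no time component, so its spatial square sum is nonnegative. This reads
    [2 a b <x, y> <= - (a^2 + b^2)]. *)
Lemma lorentz_hyperbolic_lt0 x y :
  @hyperbolic_space R n x -> @hyperbolic_space R n y -> lorentz x y < 0.
Proof.
move=> [xx x0] [yy y0]; set a := x 0 ord0 in x0; set b := y 0 ord0 in y0.
have sx := lorentz_sqr x; have sy := lorentz_sqr y.
rewrite xx in sx; rewrite yy in sy.
have : 0 <= \sum_(i < n) (b * x 0 (lift ord0 i) - a * y 0 (lift ord0 i)) ^+ 2.
  by apply: sumr_ge0 => i _; exact: sqr_ge0.
have -> : \sum_(i < n) (b * x 0 (lift ord0 i) - a * y 0 (lift ord0 i)) ^+ 2 =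
    b ^+ 2 * (\sum_(i < n) x 0 (lift ord0 i) ^+ 2) +
    a ^+ 2 * (\sum_(i < n) y 0 (lift ord0 i) ^+ 2) -
    (a * b *+ 2) * (lorentz x y + a * b).
  rewrite [lorentz x y + _]addrAC addNr add0r !mulr_sumr -sumrN -!big_split /=.
  by apply: eq_bigr => i _; ring.
rewrite sx sy -/a -/b => H.
have ab : 0 < a * b by rewrite mulr_gt0.
rewrite -(pmulr_rlt0 _ ab).
have : 0 < a ^+ 2 + b ^+ 2 by rewrite addr_gt0 ?exprn_gt0.
have -> : lorentz x y = (lorentz x y + a * b) - a * b by ring.
move: H; set s := lorentz x y + _; lra.
Qed.

(** Subtracting [(b / a) x] removes the time component of [v]; the spatial square sum of the
    remainder is [<v, v> - (b / a)^2]. *)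
Lemma lorentz_tangent_ge x (v : 'rV[R]_n.+1) : @hyperbolic_space R n x -> lorentz x v = 0 ->
  (v 0 ord0 / x 0 ord0) ^+ 2 <= lorentz v v.
Proof.
move=> [xx x0] xv; set a := x 0 ord0 in x0 *; set b := v 0 ord0.
have sx := lorentz_sqr x; have sv := lorentz_sqr v; rewrite xx in sx.
have : 0 <= \sum_(i < n) (v 0 (lift ord0 i) - b / a * x 0 (lift ord0 i)) ^+ 2.
  by apply: sumr_ge0 => i _; exact: sqr_ge0.
have -> : \sum_(i < n) (v 0 (lift ord0 i) - b / a * x 0 (lift ord0 i)) ^+ 2 =
    \sum_(i < n) v 0 (lift ord0 i) ^+ 2 +
    (b / a) ^+ 2 * (\sum_(i < n) x 0 (lift ord0 i) ^+ 2) -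
    (b / a *+ 2) * (lorentz x v + a * b).
  rewrite [lorentz x v + _]addrAC addNr add0r !mulr_sumr -sumrN -!big_split /=.
  by apply: eq_bigr => i _; ring.
rewrite sx sv xv -/a -/b.
have -> : b = b / a * a by rewrite divfK ?gt_eqF.
rewrite mulfK ?gt_eqF //; set s := b / a => H; rewrite -subr_ge0.
by apply: le_trans H _; rewrite le_eqVlt; apply/orP; left; apply/eqP; ring.
Qed.

Lemma lorentz_tangent_gt0 x (v : 'rV[R]_n.+1) : @hyperbolic_space R n x -> lorentz x v = 0 ->
  v != 0 -> 0 < lorentz v v.
Proof.
move=> hx xv v0; have H := lorentz_tangent_ge hx xv.
rewrite lt_def (le_trans (sqr_ge0 _) H) andbT; apply: contra v0 => /eqP vv0.
have {}H : v 0 ord0 = 0.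
  apply/eqP; move: H; rewrite vv0 exprn_even_le0 //= mulf_eq0 invr_eq0.
  by rewrite (gt_eqF hx.2) orbF.
have /eqP := lorentz_sqr v; rewrite vv0 H expr0n addr0 psumr_eq0 => [/allP h|i _]; last first.
  exact: sqr_ge0.
apply/eqP/rowP => j; rewrite mxE; case: (unliftP ord0 j) => [i ->|-> //].
by have := h i (mem_index_enum _); rewrite /= sqrf_eq0 => /eqP.
Qed.

Lemma lorentz_tangent_nneg x (v : 'rV[R]_n.+1) : @hyperbolic_space R n x -> lorentz x v = 0 ->
  0 <= lorentz v v.
Proof. by move=> hx xv; apply: le_trans (sqr_ge0 _) (lorentz_tangent_ge hx xv). Qed.

End lorentz_algebra.

(** * Differentiation of maps into Minkowski space and the ambient product *)

Section derivatives.
Variables (R : realType) (V : normedModType R).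

(** Both maps have the same first-order expansion at [x], and the differential is unique. It serves
    to differentiate identities that hold only near a point. *)
Lemma near_eq_diff (W : normedModType R) (f g : V -> W) (x : V) :
  (\forall y \near x, f y = g y) -> differentiable f x ->
  differentiable g x /\ forall v, 'D_v g x = 'D_v f x.
Proof.
move=> fg df; have fgx : f x = g x := nbhs_singleton fg.
have E : g \o shift x = cst (g x) + 'd f x +o_0 id.
  apply/eqaddoP => e e0; have /eqaddoP/(_ e e0) H := diff_locally df.
  have : \forall h \near 0, f (h + x) = g (h + x).
    by move: fg; rewrite (near_shift 0) /= subr0.
  by move=> /(filterI H); apply: filterS => h [H1 Eh]; move: H1; rewrite !fctE /= fgx Eh.
have dE := diff_unique (diff_continuous df) E.
have dg : differentiable g x.
  by apply/diff_locallyP; rewrite dE; split; [exact: diff_continuous|exact: E].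
by split=> // v; rewrite !deriveE // dE.
Qed.

Lemma diff_fst (W1 W2 : normedModType R) (f : V -> W1 * W2) x :
  differentiable f x -> differentiable (fun y => (f y).1) x /\
    forall v, 'D_v (fun y => (f y).1) x = ('D_v f x).1.
Proof.
move=> df; have c : continuous (fst : W1 * W2 -> W1) by move=> p; exact: cvg_fst.
have d1 := linear_differentiable (f x) c.
have dd : differentiable (fun y => (f y).1) x by exact: (differentiable_comp df d1).
by split=> // v; rewrite !deriveE // (diff_comp df d1) /= (diff_lin _ c).
Qed.

Lemma diff_snd (W1 W2 : normedModType R) (f : V -> W1 * W2) x :
  differentiable f x -> differentiable (fun y => (f y).2) x /\
    forall v, 'D_v (fun y => (f y).2) x = ('D_v f x).2.
Proof.
move=> df; have c : continuous (snd : W1 * W2 -> W2) by move=> p; exact: cvg_snd.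
have d1 := linear_differentiable (f x) c.
have dd : differentiable (fun y => (f y).2) x by exact: (differentiable_comp df d1).
by split=> // v; rewrite !deriveE // (diff_comp df d1) /= (diff_lin _ c).
Qed.

Lemma diff_lorentz n (f g : V -> 'rV[R]_n.+1) x :
  differentiable f x -> differentiable g x ->
  differentiable (fun y => lorentz (f y) (g y)) x /\
  forall v, 'D_v (fun y => lorentz (f y) (g y)) x =
    lorentz ('D_v f x) (g x) + lorentz (f x) ('D_v g x).
Proof.
move=> df dg.
have co (h : V -> 'rV[R]_n.+1) i : differentiable h x ->
    differentiable (fun y => h y 0 i : R) x.
  by move=> dh; exact: (differentiable_comp dh (differentiable_coord (h x) 0 i)).
have cD (h : V -> 'rV[R]_n.+1) i v : differentiable h x ->
    is_derive x v (fun y => h y 0 i : R) (('D_v h x) 0 i).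
  move=> dh; split; first exact: diff_derivable (co h i dh).
  by rewrite derive_mx ?mxE //; exact: diff_derivable.
have E : (fun y => lorentz (f y) (g y)) = - ((fun y => f y 0 ord0) * (fun y => g y 0 ord0)) +
    \sum_(i < n) (fun y => f y 0 (lift ord0 i)) * (fun y => g y 0 (lift ord0 i)).
  by apply/funext => y; rewrite /lorentz !fctE /= fct_sumE.
rewrite E; split.
  apply: differentiableD.
    by apply: differentiableN; apply: differentiableM; [exact: co df|exact: co dg].
  by apply: differentiable_sum => i; apply: differentiableM; [exact: co df|exact: co dg].
move=> v.
have H i := is_deriveM (cD f i v df) (cD g i v dg).
have [_ ->] := is_deriveD (is_deriveN (H ord0)) (is_derive_sum (fun i => H (lift ord0 i))).
rewrite /lorentz addrACA -big_split /= -opprD; congr (- _ + _).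
  by rewrite addrC; congr (_ + _); rewrite mulrC.
by apply: eq_bigr => i _; rewrite addrC; congr (_ + _); rewrite mulrC.
Qed.

Lemma diff_pmetric n (f g : V -> ambient R n) x :
  differentiable f x -> differentiable g x ->
  differentiable (fun y => pmetric (f y) (g y)) x /\
  forall v, 'D_v (fun y => pmetric (f y) (g y)) x =
    pmetric ('D_v f x) (g x) + pmetric (f x) ('D_v g x).
Proof.
move=> df dg.
have [df1 Df1] := diff_fst df; have [dg1 Dg1] := diff_fst dg.
have [df2 Df2] := diff_snd df; have [dg2 Dg2] := diff_snd dg.
have [dl Dl] := diff_lorentz df1 dg1.
have dm := differentiableM df2 dg2.
split; first exact: differentiableD dl dm.
move=> v; rewrite [LHS](deriveD (diff_derivable dl) (diff_derivable dm)) Dl Df1 Dg1.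
rewrite deriveM ?Df2 ?Dg2; [|exact: diff_derivable|exact: diff_derivable].
rewrite /pmetric [RHS]addrACA; congr (_ + _); rewrite addrC; congr (_ + _).
exact: mulrC.
Qed.

Lemma diff_pmetric_cst n (f : V -> ambient R n) (w : ambient R n) x :
  differentiable f x ->
  differentiable (fun y => pmetric (f y) w) x /\
  forall v, 'D_v (fun y => pmetric (f y) w) x = pmetric ('D_v f x) w.
Proof.
move=> df; have [d D] := diff_pmetric df (differentiable_cst w x).
by split=> // v; rewrite D derive_cst pmetric0r addr0.
Qed.

End derivatives.

(** * Contact with the barrier *)

Section normal.
Variables (R : realType) (n : nat).
Implicit Types (x : 'rV[R]_n.+1) (u w : ambient R n).

(** Coordinates on the ambient space as row vectors, so that a dimension count becomes invertibility
    of a square matrix. *)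
Definition flat (u : ambient R n) : 'rV[R]_(n.+1 + 1) := row_mx u.1 (const_mx u.2).

Lemma flat_is_linear : linear flat.
Proof.
move=> a u v; rewrite /flat scale_row_mx add_row_mx; congr row_mx.
by apply/rowP => i; rewrite !mxE.
Qed.

HB.instance Definition _ := GRing.isLinear.Build R (ambient R n) 'rV[R]_(n.+1 + 1)
  *:%R flat flat_is_linear.

Lemma flat_inj : injective flat.
Proof.
move=> [u1 u2] [v1 v2] /eq_row_mx[/= -> /matrixP/(_ 0 0)].
by rewrite !mxE => ->.
Qed.

Lemma tangent_pos x u : @hyperbolic_space R n x -> lorentz x u.1 = 0 ->
  u != 0 -> 0 < pmetric u u.
Proof.
move=> hx; case: u => u1 u2 /= xu u0; rewrite /pmetric /=.
have [u10|u10] := eqVneq u1 0; last first.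
  by rewrite ltr_pwDl ?(lorentz_tangent_gt0 hx) // -expr2 sqr_ge0.
rewrite ltr_wpDl ?(lorentz_tangent_nneg hx) // -expr2 exprn_even_gt0 //=.
by apply: contra u0 => /eqP ->; rewrite u10.
Qed.

(** The normal [N], the [n]-dimensional image of [T] and the position vector [X] span the ambient
    space of dimension [n + 2]. Since [u] is orthogonal to all of them, [pmetric u u = 0], and the
    metric is positive definite on vectors tangent to the product. *)
Lemma normal_complement (T : {linear 'rV[R]_n -> ambient R n}) x (N u : ambient R n) :
  @hyperbolic_space R n x -> injective T ->
  (forall v, lorentz x (T v).1 = 0) -> lorentz x N.1 = 0 -> pmetric N N = 1 ->
  (forall v, pmetric (T v) N = 0) ->
  lorentz x u.1 = 0 -> pmetric u N = 0 -> (forall v, pmetric (T v) u = 0) -> u = 0.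
Proof.
move=> hx Tinj xT xN NN TN xu uN Tu.
pose X : ambient R n := (x, 0).
have pX v : pmetric v X = lorentz x v.1 by rewrite /pmetric /= mulr0 addr0 lorentzC.
pose K : 'M[R]_(n.+1 + 1) :=
  col_mx (col_mx (flat N) (lin1_mx (flat \o T)) : 'M[R]_((1 + n)%N, (n.+1 + 1)%N)) (flat X).
have KE (a : R) (v : 'rV_n) (b : R) :
    row_mx (row_mx a%:M v : 'rV_(1 + n)) b%:M *m K = flat (a *: N + T v + b *: X).
  by rewrite /K !mul_row_col !mul_scalar_mx mul_rV_lin1 /= !linearD !linearZ.
have surj (z : 'rV[R]_(n.+1 + 1)) : exists (a : R) v (b : R),
    z = row_mx (row_mx a%:M v : 'rV_(1 + n)) b%:M.
  exists (lsubmx (lsubmx z : 'rV_(1 + n)) 0 0),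
    (rsubmx (lsubmx z : 'rV_(1 + n))), (rsubmx z 0 0).
  by rewrite -!mx11_scalar !hsubmxK.
have Ku : K \in unitmx.
  rewrite unitmxE unitfE; apply/det0P => -[z z0 zK].
  have [a [v [b zE]]] := surj z; move: zK; rewrite zE KE -[0](linear0 flat).
  move/flat_inj => E; move: z0; rewrite zE.
  (* In a vanishing combination, pairing with [X] kills [b], pairing with [N] kills [a], and
     injectivity of [T] kills [v]. *)
  have b0 : b = 0.
    have := congr1 (fun z => pmetric z X) E.
    rewrite /= pmetric0l !pmetricDl !pmetricZl !pX xN xT hx.1 mulr0 !add0r => /eqP.
    by rewrite mulrN1 oppr_eq0 => /eqP.
  have a0 : a = 0.
    have := congr1 (fun z => pmetric z N) E.
    by rewrite /= pmetric0l b0 scale0r addr0 pmetricDl pmetricZl NN TN addr0 mulr1.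
  move: E; rewrite a0 b0 !scale0r add0r addr0 -(linear0 T) => /Tinj ->.
  by rewrite raddf0 !row_mx0 eqxx.
have [a [v [b E]]] := surj (flat u *m invmx K).
have uE : u = a *: N + T v + b *: X.
  by apply: flat_inj; rewrite -KE -E mulmxKV.
apply/eqP; apply: contraT => /(tangent_pos hx xu).
rewrite {1}uE !pmetricDl !pmetricZl Tu (pmetricC N) uN (pmetricC X) pX xu.
by rewrite !mulr0 !addr0 ltxx.
Qed.

End normal.

Section touching.
Variables (R : realType) (n : nat) (F : 'rV[R]_n -> ambient R n) (x0 : 'rV[R]_n).
Variable N : ambient R n.
Hypothesis dF : \forall x \near x0, differentiable F x.
Hypothesis ddF : forall v, differentiable ('D_v F) x0.

Let dF0 : differentiable F x0 := nbhs_singleton dF.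

(** Pairing with a constant vector commutes with differentiation, so the scalar results on second
    derivatives apply to [F]. *)
Lemma second_derive_scalar (u : ambient R n) v :
  let f x := pmetric (F x) u in
  [/\ \forall x \near x0, differentiable f x, differentiable ('D_v f) x0,
    'D_v f x0 = pmetric ('D_v F x0) u &
    forall v', 'D_v' ('D_v f) x0 = pmetric ('D_v' ('D_v F) x0) u].
Proof.
move=> f.
have Df : \forall x \near x0, pmetric ('D_v F x) u = 'D_v f x.
  by apply: filterS dF => x /(diff_pmetric_cst u)[_ ->].
have [d2 D2] := diff_pmetric_cst u (ddF v).
have [d2' D2'] := near_eq_diff Df d2.
split=> //.
- by apply: filterS dF => x /(diff_pmetric_cst u)[].
- by have [_ ->] := diff_pmetric_cst u dF0.
- by move=> v'; rewrite D2' D2.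
Qed.

Lemma second_form_sym : (second_form F N x0)^T = second_form F N x0.
Proof.
apply/matrixP => i j; rewrite !mxE /partial.
have [d di _ Ei] := second_derive_scalar N (delta_mx 0 i).
have [_ dj _ Ej] := second_derive_scalar N (delta_mx 0 j).
have := symmetric_second_derivative d di dj; rewrite Ei Ej.
exact.
Qed.

Lemma first_form_sym : (first_form F x0)^T = first_form F x0.
Proof. by apply/matrixP => i j; rewrite !mxE; exact: pmetricC. Qed.

Lemma derive_sum_partial (W : normedModType R) (f : 'rV[R]_n -> W) x v :
  differentiable f x -> 'D_v f x = \sum_i v 0 i *: partial i f x.
Proof.
move=> df; rewrite deriveE // {1}[v]row_sum_delta linear_sum.
by apply: eq_bigr => i _; rewrite linearZ /= /partial deriveE.
Qed.

Lemma first_formE v :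
  (v *m first_form F x0 *m v^T) 0 0 = pmetric ('D_v F x0) ('D_v F x0).
Proof.
rewrite {1}derive_sum_partial // derive_sum_partial // pmetric_sumr mxE.
apply: eq_bigr => j _; rewrite mxE pmetricZr mulrC [v^T _ _]mxE; congr (_ * _).
rewrite pmetric_suml; apply: eq_bigr => i _; by rewrite pmetricZl mxE.
Qed.

Lemma second_formE v :
  (v *m second_form F N x0 *m v^T) 0 0 = pmetric ('D_v ('D_v F) x0) N.
Proof.
have E : (fun x => \sum_i v 0 i *: partial i F x) = \sum_i (v 0 i \*: partial i F).
  by rewrite fct_sumE.
(* This expansion is available only near [x0], which suffices to take the outer derivative there. *)
have near_sum : \forall x \near x0, (\sum_i (v 0 i \*: partial i F)) x = 'D_v F x.
  by apply: filterS dF => x dx; rewrite -E derive_sum_partial.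
have dZ i : differentiable (v 0 i \*: partial i F) x0.
  by apply: differentiableZ; exact: ddF.
have [_ ->] := near_eq_diff near_sum (differentiable_sum dZ).
rewrite derive_sum => [|i]; last exact: diff_derivable.
rewrite pmetric_suml mxE; apply: eq_bigr => j _.
rewrite deriveZ; last exact/diff_derivable/ddF.
rewrite pmetricZl derive_sum_partial; last exact: ddF.
rewrite mulrC [v^T _ _]mxE; congr (_ * _).
rewrite pmetric_suml mxE; apply: eq_bigr => i _.
by rewrite pmetricZl mxE.
Qed.

Hypothesis hF : \forall x \near x0, @hyperbolic_space R n (F x).1.

(** Differentiate [<F, F> = -1]. At each nearby [x] the identity has to hold in a neighbourhood of
    [x], hence the passage to the interior. *)
Lemma tangent_near v : \forall x \near x0, lorentz (F x).1 ('D_v F x).1 = 0.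
Proof.
have := nbhs_interior hF; apply: filterS2 dF => x dx hx.
have [d1 D1] := diff_fst dx; have [_ D] := diff_lorentz d1 d1.
have fE : \forall y \near x, cst (-1) y = lorentz (F y).1 (F y).1.
  by apply: filterS hx => y [->].
have [_ D0] := near_eq_diff fE (differentiable_cst _ _).
have := D v; rewrite D0 derive_cst D1 [lorentz _ (F x).1]lorentzC => /esym/eqP.
by rewrite -mulr2n mulrn_eq0 /= => /eqP.
Qed.

(** Differentiate the orthogonality of [F] and ['D_v F] once more. *)
Lemma tangent_second v : lorentz (F x0).1 ('D_v ('D_v F) x0).1 =
  - lorentz ('D_v F x0).1 ('D_v F x0).1.
Proof.
have [d1 D1] := diff_fst dF0; have [d2 D2] := diff_fst (ddF v).
have [d D] := diff_lorentz d1 d2.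
have fE : \forall y \near x0, cst 0 y = lorentz (F y).1 ('D_v F y).1.
  by apply: filterS (tangent_near v) => y ->.
have [_ D0] := near_eq_diff fE (differentiable_cst _ _).
have := D v; rewrite D0 derive_cst D1 D2 => /esym/eqP.
by rewrite addrC addr_eq0 => /eqP.
Qed.

Hypothesis dFinj : injective ('d F x0 : 'rV[R]_n -> ambient R n).
Hypothesis normalH : lorentz (F x0).1 N.1 = 0.
Hypothesis normal1 : pmetric N N = 1.
Hypothesis normalT : forall v, pmetric ('d F x0 v) N = 0.

Let hF0 : @hyperbolic_space R n (F x0).1 := nbhs_singleton hF.
Let tangent0 v : lorentz (F x0).1 ('D_v F x0).1 = 0 := nbhs_singleton (tangent_near v).

Lemma derive_neq0 (v : 'rV[R]_n) : v != 0 -> 'D_v F x0 != 0.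
Proof.
apply: contra_neq => D0; apply: dFinj.
by rewrite -deriveE // D0 linear0.
Qed.

Lemma first_form_pos (v : 'rV[R]_n) : v != 0 -> 0 < (v *m first_form F x0 *m v^T) 0 0.
Proof.
by move=> v0; rewrite first_formE; apply: (tangent_pos hF0) => //; exact: derive_neq0.
Qed.

Variables (o : 'rV[R]_n.+1) (e : R).
Hypothesis ho : @hyperbolic_space R n o.
Hypothesis he : e ^+ 2 = 1.
Let b : ambient R n := (o, e).
Hypothesis Fmin : \forall x \near x0, pmetric (F x0) b <= pmetric (F x) b.

(* Where <F, b> is critical, the null vector b = (o, e) has no component along
   the hypersurface: b = lam N + c X with X the position vector, <X, X> = -1,
   so that lam^2 = c^2.  Pairing b with the second derivative of F then turns
   the minimality of <F, b> into the bound on the second form. *)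
Lemma touching_second_form : exists s : R, s ^+ 2 = 1 /\ forall v,
  lorentz ('D_v F x0).1 ('D_v F x0).1 <= s * (v *m second_form F N x0 *m v^T) 0 0.
Proof.
pose X : ambient R n := ((F x0).1, 0).
have crit v : pmetric ('D_v F x0) b = 0 /\ 0 <= pmetric ('D_v ('D_v F) x0) b.
  have [d dv <- <-] := second_derive_scalar b v.
  exact: second_derivative_test d dv Fmin.
pose c := - lorentz (F x0).1 o.
have c0 : 0 < c by rewrite oppr_gt0; exact: lorentz_hyperbolic_lt0.
pose lam := pmetric b N.
have pX v : pmetric v X = lorentz (F x0).1 v.1 by rewrite /pmetric /= mulr0 addr0 lorentzC.
have bE : b = lam *: N + c *: X.
  (* The difference is orthogonal to [X] and [N] by the choice of [c] and [lam], and to the image of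
     the differential by criticality. *)
  apply/eqP; rewrite -subr_eq0; apply/eqP.
  apply: (@normal_complement _ _ ('d F x0) (F x0).1 N) => //.
  - by move=> v; rewrite -deriveE.
  - rewrite -pX -scaleN1r pmetricDl pmetricZl pmetricDl !pmetricZl !pX /= normalH hF0.1 /c.
    by ring.
  - rewrite -scaleN1r pmetricDl pmetricZl pmetricDl !pmetricZl normal1 (pmetricC X) pX normalH.
    by rewrite -/lam; ring.
  - move=> v; rewrite -scaleN1r pmetricDr pmetricZr pmetricDr !pmetricZr normalT pX.
    by rewrite -deriveE // tangent0 (crit v).1; ring.
have bb : pmetric b b = 0 by rewrite /pmetric /= ho.1 -expr2 he addNr.
have lam2 : lam ^+ 2 = c ^+ 2.
  have : pmetric b X = - c by rewrite pX opprK.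
  move: bb; rewrite {2}bE pmetricDr !pmetricZr -/lam => + H; rewrite H.
  by rewrite mulrN => /eqP; rewrite subr_eq0 -!expr2 => /eqP.
exists (lam / c); split; first by rewrite expr_div_n lam2 divff // expf_neq0 // gt_eqF.
move=> v; have [_] := crit v; rewrite second_formE bE pmetricDr !pmetricZr pX tangent_second.
rewrite mulrN subr_ge0 => H.
by rewrite mulrAC ler_pdivlMr // mulrC.
Qed.

(** The lower bound for the second form is the squared length of the horizontal part of ['D_v F]. It
    equals the first form where the height derivative vanishes, a single linear condition on [v]. *)
Lemma touching_definite : exists s : R, s ^+ 2 = 1 /\
  (forall v : 'rV[R]_n, v != 0 -> 0 < s * (v *m second_form F N x0 *m v^T) 0 0) /\
  (forall v : 'rV[R]_n, (v *m \col_i (partial i F x0).2) 0 0 = 0 ->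
     (v *m first_form F x0 *m v^T) 0 0 <= s * (v *m second_form F N x0 *m v^T) 0 0).
Proof.
have [s [s2 H]] := touching_second_form; exists s; split=> //; split=> [v v0|v vt].
  apply: lt_le_trans (H v); apply: (lorentz_tangent_gt0 hF0) => //.
  (* A vertical ['D_v F] pairs with [(o, e)] to [e] times its height component; criticality and
     [e != 0] then make it zero. *)
  apply: contra_neq (derive_neq0 v0) => V1.
  have [d dv D _] := second_derive_scalar b v.
  have [+ _] := second_derivative_test d dv Fmin.
  rewrite D /pmetric V1 /= -(scale0r 0) lorentzZl mul0r add0r => /eqP.
  rewrite mulf_eq0 => /orP[/eqP V2|/eqP e0].
    by apply/eqP; rewrite -pair_eqE /pair_eq /= V1 V2 !eqxx.
  by move: he; rewrite e0 expr0n => /esym/eqP; rewrite oner_eq0.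
apply: le_trans (H v); rewrite first_formE /pmetric.
suff -> : ('D_v F x0).2 = 0 by rewrite mulr0 addr0.
rewrite -vt derive_sum_partial // mxE (big_morph snd (id1 := 0) (op1 := +%R)) //.
by apply: eq_bigr => i _; rewrite mxE.
Qed.

End touching.

(** * From principal curvatures to the height estimate *)

Lemma mean_curvature_gt (R : realType) n r (k : 'I_n -> R) (s : R) :
  (1 <= r < n)%N -> s ^+ 2 = 1 -> (forall i, 0 < s * k i) ->
  (forall i j, i != j -> s * k i < 1 -> 1 <= s * k j) ->
  0 < mean_curvature r k -> (n%:R - r%:R) / n%:R < mean_curvature r k.
Proof.
move=> /andP[r1 rn] s2 kpos k1.
have n0 : (0 < n)%N by exact: leq_trans rn.
have C0 : 0 < 'C(n, r)%:R :> R by rewrite ltr0n bin_gt0 ltnW.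
have := elementary_symmetric_gt_bin (k := fun i => s * k i) _ kpos k1.
move/(_ r); rewrite r1 ltnW // => /(_ isT).
rewrite /mean_curvature; set e := \sum_(I : {set 'I_n} | #|I| == r) \prod_(i in I) k i.
have -> : \sum_(I : {set 'I_n} | #|I| == r) \prod_(i in I) (s * k i) = s ^+ r * e.
  rewrite mulr_sumr; apply: eq_bigr => I /eqP cI.
  by rewrite big_split /= prodr_const cI.
rewrite pmulr_rgt0 ?invr_gt0 // => H e0.
(* Positivity of the mean curvature fixes the sign: [s ^+ r * e] is positive, and so is [e]. *)
have sr : s ^+ r = 1.
  have : (s ^+ r) ^+ 2 == 1 by rewrite -exprM mulnC exprM s2 expr1n.
  rewrite sqrf_eq1 => /orP[/eqP //|/eqP sr].
  have : 0 < s ^+ r * e by apply: le_lt_trans H; exact: ler0n.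
  by rewrite sr mulN1r oppr_gt0 ltNge (ltW e0).
rewrite [X in _ < X]mulrC ltr_pdivlMr // mulrAC ltr_pdivrMr ?ltr0n //.
(* The threshold arises from [(n - r) 'C(n, r) = n 'C(n - 1, r)]. *)
rewrite -natrB 1?ltnW // -natrM -mul_bin_down natrM mulrC ltr_pM2r ?ltr0n //.
by rewrite sr mul1r in H.
Qed.

(** With [c = cosh d] one has [c <= c + sqrt (c^2 - 1) = exp d]. *)
Lemma hyperbolic_dist_le (R : realType) n (o x : 'rV[R]_n.+1) rho :
  @hyperbolic_space R n o -> @hyperbolic_space R n x ->
  hyperbolic_dist o x <= rho -> - expR rho <= lorentz x o.
Proof.
move=> ho hx; rewrite /hyperbolic_dist lorentzC.
have c0 : 0 < - lorentz x o by rewrite oppr_gt0 lorentz_hyperbolic_lt0.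
rewrite -ler_expR lnK; last by rewrite posrE ltr_pwDl ?sqrtr_ge0.
by move=> H; rewrite lerNl; apply: le_trans H; rewrite lerDl sqrtr_ge0.
Qed.

Lemma lorentz_closure_ge (R : realType) n (A : set 'rV[R]_n.+1) o (c : R) :
  (forall x, A x -> c <= lorentz x o) -> forall x, closure A x -> c <= lorentz x o.
Proof.
move=> H x; have cl : closed [set x : 'rV[R]_n.+1 | c <= lorentz x o].
  apply: (@preimage_closed _ _ (fun x => lorentz x o) [set y | c <= y]); last exact: closed_ge.
  move=> y _; apply: differentiable_continuous.
  by have [] := diff_lorentz (@ex_diff _ _ _ _ _ _ _ (is_diff_id y)) (differentiable_cst o y).
by move=> /(closureS H); rewrite -((closure_id _).1 cl).
Qed.

Section immersion.
Variables (R : realType) (n : nat) (M : topologicalType) (phi : M -> ambient R n).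

(** Near each point [phi] is the composition of a chart coordinate with its smooth [ext]. *)
Lemma immersed_continuous : immersed_hypersurface phi -> continuous phi.
Proof.
move=> [_ _ charts] p; have [c cp] := charts p.
have cc : {for p, continuous (Defs.coord c)}.
  have := @Defs.coord_continuous _ _ _ _ c.
  rewrite continuous_open_subspace; last exact: chart_dom_open.
  by apply; rewrite inE.
have rp : chart_range c (Defs.coord c p).
  have : (Defs.coord c @` chart_dom c) (Defs.coord c p) by exists p.
  by rewrite coord_image => -[].
have ce : {for Defs.coord c p, continuous (ext c)}.
  by have [d _] := ext_smooth c 1; apply: differentiable_continuous; exact: d.
have : ext c \o Defs.coord c @ p --> phi p.
  by rewrite -(extE cp); exact: continuous_comp cc ce.
apply: cvg_trans; apply: near_eq_cvg.
have : \forall q \near p, chart_dom c q.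
  by apply: open_nbhs_nbhs; split => //; exact: chart_dom_open.
by apply: filterS => q cq /=; rewrite extE.
Qed.

End immersion.

(** In a chart at [p], minimality becomes a local minimum of [<F, (o, e)>] on an open set of
    coordinates. The resulting curvature bounds force [H_r] above [(n - r) / n]. *)
Lemma interior_not_minimal (R : realType) n r (M : topologicalType)
    (phi N : M -> ambient R n) (p : M) (k : 'I_n -> R) (o : 'rV[R]_n.+1) (e : R) :
  (1 <= r < n)%N -> immersed_hypersurface phi -> unit_normal_field phi N ->
  principal_curvatures phi N p k ->
  0 < mean_curvature r k <= (n%:R - r%:R) / n%:R ->
  ~ manifold_boundary phi p -> @hyperbolic_space R n o -> e ^+ 2 = 1 ->
  ~ (forall q, pmetric (phi p) ((o, e) : ambient R n) <=
       pmetric (phi q) ((o, e) : ambient R n)).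
Proof.
move=> hr [_ phiH _] [_ NH N1 NT] [c [cp charE]] /andP[H0 Hle] nb ho he pmin.
have n0 : (0 < n)%N by case/andP: hr => _; exact: leq_trans.
set F := ext c in charE; set x0 := Defs.coord c p in charE.
pose i0 := Ordinal n0.
have [rx0 hx0] : (chart_range c `&` @half_space R n) x0.
  by rewrite -coord_image; exists p.
have x00 : 0 < x0 0 i0.
  rewrite lt_def hx0 // andbT; apply/eqP => x0E; apply: nb; exists c; split=> // i i_0.
  by rewrite (_ : i = i0) //; apply: val_inj.
have near_range : \forall x \near x0, chart_range c x.
  by apply: open_nbhs_nbhs; split => //; exact: chart_range_open.
(* [ext] follows [M] only over the half-space. As [p] is not a boundary point, the coordinate
   [x0 0 i0] is positive, so all nearby [x] are coordinates of points of [M]. *)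
have near_chart : \forall x \near x0, exists2 q, x = Defs.coord c q & F x = phi q.
  have near_half : \forall x \near x0, 0 < (x : 'rV[R]_n) 0 i0.
    have cx : {for x0, continuous (fun x : 'rV[R]_n => x 0 i0)} by exact: coord_continuous.
    exact: (cvgr_gt _ cx).
  apply: filterS2 near_range near_half => x rx hx.
  have : (Defs.coord c @` chart_dom c) x.
    rewrite coord_image; split=> // i i_0; rewrite (_ : i = i0) ?ltW //.
    exact: val_inj.
  by move=> [q cq <-]; exists q => //; rewrite /F extE.
have Fp : F x0 = phi p by exact: extE.
have dF : \forall x \near x0, differentiable F x.
  by apply: filterS near_range => x; have [d _] := ext_smooth c 1; exact: d.
have ddF v : differentiable ('D_v F) x0.
  by have [_ /(_ v)[d _]] := ext_smooth c 2; exact: d.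
have hF : \forall x \near x0, @hyperbolic_space R n (F x).1.
  by apply: filterS near_chart => x [q _ ->]; exact: phiH.
have inj := ext_immersion (conj rx0 hx0 : (chart_range c `&` @half_space R n) x0).
have normalH : lorentz (F x0).1 (N p).1 = 0 by rewrite Fp; exact: NH.
have normalT v : pmetric ('d F x0 v) (N p) = 0.
  by apply: NT; exists c; split=> //; exists v.
have Fmin : \forall x \near x0,
    pmetric (F x0) ((o, e) : ambient R n) <= pmetric (F x) ((o, e) : ambient R n).
  by apply: filterS near_chart => x [q _ ->]; rewrite Fp; exact: pmin.
have [s [s2 [Bpos Bge]]] :=
  touching_definite dF ddF hF inj normalH (N1 p) normalT ho he Fmin.
have Gpos := first_form_pos dF hF inj.
have Gu : first_form F x0 \in unitmx.
  rewrite unitmxE unitfE; apply/det0P => -[v v0 vG].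
  by have := Gpos v v0; rewrite vG mul0mx mxE ltxx.
have detE : \det (pencil (first_form F x0) (second_form F (N p) x0)) =
    \det (first_form F x0) *: \prod_(i < n) ('X - (k i)%:P).
  by rewrite det_pencil // -charE.
have Gdet : \det (first_form F x0) != 0 by rewrite -unitfE -unitmxE.
have [kpos k1] := eigenvalues_ge1 Gpos (first_form_sym F x0)
  (second_form_sym _ dF ddF) Gdet detE Bpos Bge.
have := mean_curvature_gt hr s2 kpos k1 H0.
by rewrite ltNge Hle.
Qed.

Theorem theorem6p2 (R : realType) (n : nat) (Omega : set 'rV[R]_n.+1)
    (hOmega : bounded_domain Omega) :
  exists C : R,
  forall (r : nat) (hr : (1 <= r < n)%N)
    (M : topologicalType) (phi N : M -> ambient R n) (k : M -> 'I_n -> R),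
    compact [set: M] ->
    connected [set: M] ->
    immersed_hypersurface phi ->
    unit_normal_field phi N ->
    (forall p, principal_curvatures phi N p (k p)) ->
    (forall p, 0 < mean_curvature r (k p) <= (n%:R - r%:R) / n%:R) ->
    (forall p, manifold_boundary phi p -> height phi p = 0) ->
    phi @` manifold_boundary phi =
      slice0 (n := n) @` relative_boundary (@hyperbolic_space R n) Omega ->
    forall p : M, `|height phi p| <= C.
Proof.
have [subO _ _ _ [ o [ho [rho Orho]]]] := hOmega.
(* This bounds [cosh d(o, x)] on [Omega]; [o] and [rho] are chosen before [r] and [M]. *)
exists (expR rho) => r hr M phi N k cM _ imm nor curv Hr _ bd.
have Oge x : closure Omega x -> - expR rho <= lorentz x o.
  apply: lorentz_closure_ge => y Oy; apply: hyperbolic_dist_le => //; first exact: subO.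
  exact: Orho.
have bound (e : R) (p : M) : e ^+ 2 = 1 -> - expR rho <= e * height phi p.
  move=> he; pose b : ambient R n := (o, e).
  have cb : continuous (fun q => pmetric (phi q) b).
    move=> q; have [d _] := diff_pmetric_cst b (@ex_diff _ _ _ _ _ _ _ (is_diff_id (phi q))).
    apply: (@continuous_comp _ _ _ phi (fun u => pmetric u b) q).
      exact: immersed_continuous.
    exact: differentiable_continuous.
  have [p0 _ pmin] : exists2 p0, p0 \in [set: M] &
      forall q, q \in [set: M] -> pmetric (phi p0) b <= pmetric (phi q) b.
    apply: compact_EVT_min => //; first by exists p.
    by apply: continuous_subspaceT.
  have {}pmin q : pmetric (phi p0) b <= pmetric (phi q) b by apply: pmin; rewrite inE.
  have [bp0|nb] := pselect (manifold_boundary phi p0); last first.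
    by have := interior_not_minimal hr imm nor (curv p0) (Hr p0) nb ho he pmin.
  have : (phi @` manifold_boundary phi) (phi p0) by exists p0.
  rewrite bd => -[x [_ [clx _]] xE].
  have := pmin p; rewrite -xE /pmetric /= mul0r addr0 => H.
  rewrite mulrC -[leRHS]add0r; apply: le_trans (Oge _ clx) _; apply: le_trans H _.
  by rewrite lerD2r ltW // lorentz_hyperbolic_lt0 //; case: imm => _ + _; apply.
move=> p; rewrite ler_norml; apply/andP; split.
  by have := bound 1 p (expr1n _ _); rewrite mul1r.
by have := bound (-1) p (sqrr_sign _ 1); rewrite mulN1r lerN2.
Qed.
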